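(* Let $k$ be a field and let $F=\{f_1,\ldots,f_q\}\subset R=k[\mathbf{x}]=k[x_1,\ldots,x_n]$ be a set of $q$ (distinct, nonzero) forms of fixed degree $d\geq 2$. Suppose one has a partition $\mathbf{x}=\mathbf{y}\cup\mathbf{z}$ of the variables such that $F=G\cup H$, where the forms in the set $G$ (respectively, $H$) involve only the $\mathbf{y}$-variables (respectively, $\mathbf{z}$-variables). If neither $G$ nor $H$ is empty then: (i) The extension $k[F]\subset k[\mathbf{x}_d]$ is not birational, where $\mathbf{x}_d$ is the set of all monomials of degree $d$ in $R$. (ii) The linear syzygy matrix of $F$ does not have maximal rank, i.e. its rank is not equal to $q-1$.
   Context: A form is a homogeneous polynomial. $k[F]$ denotes the $k$-subalgebra of $R$ generated by $F$. An extension $D'\subset D$ of integral domains is birational if $D'$ and $D$ have the same field of fractions. The linear syzygy matrix of $F$ is the matrix with $q$ rows whose columns span the $k$-space of linear syzygies of $F$, i.e. of the vectors $(l_1,\ldots,l_q)$ of linear forms in $R$ (homogeneous of degree 1 or zero) with $\sum_i l_if_i=0$. Its rank is taken over the fraction field of $R$; maximal rank means rank $q-1$, the rank of the full syzygy module of $F$. *)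

(* Defs.v *)
From HB Require Import structures.
From mathcomp Require Import all_boot all_order all_algebra.
From mathcomp Require Import mpoly.

Set Implicit Arguments.
Unset Strict Implicit.
Unset Printing Implicit Defensive.

Import GRing.Theory.

Local Open Scope ring_scope.

Section Subalgebras.
Variables (k : fieldType) (n : nat).
Local Notation R := {mpoly k[n]}.

Definition is_form (d : nat) (f : R) : bool := (f \is d.-homog) && (f != 0).

Definition involves_only (Y : {set 'I_n}) (f : R) : Prop :=
  forall (m : 'X_{1..n}) (i : 'I_n), m \in msupp f -> m i != 0%N -> i \in Y.

Inductive gen_subalg (A : R -> Prop) : R -> Prop :=
| gen_subalg_mem p : A p -> gen_subalg A p
| gen_subalg_const c : gen_subalg A c%:MP
| gen_subalg_add p q :
    gen_subalg A p -> gen_subalg A q -> gen_subalg A (p + q)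
| gen_subalg_mul p q :
    gen_subalg A p -> gen_subalg A q -> gen_subalg A (p * q).

Definition monomials (d : nat) (p : R) : Prop :=
  exists2 m : 'X_{1..n}, mdeg m = d & p = 'X_[m].

(* The field of fractions of a subring D of R, realized inside Frac R. *)
Definition frac_field (D : R -> Prop) (x : {fraction R}) : Prop :=
  exists a b : R, [/\ D a, D b, b != 0 & x = tofrac a / tofrac b].

(* The inclusion D' <= D is not part of this predicate, so that its negation
   speaks about the fraction fields only; for the extension of interest the
   inclusion is gen_subalg_forms below. *)
Definition birational (D' D : R -> Prop) : Prop :=
  forall x : {fraction R}, frac_field D' x <-> frac_field D x.

Lemma gen_subalg_forms (d : nat) (F : seq R) :
  {in F, forall f, is_form d f} ->
  forall p, gen_subalg (fun f => f \in F) p -> gen_subalg (monomials d) p.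
Proof.
move=> hF p; elim=> {p} [p pF|c|p q _ hp _ hq|p q _ hp _ hq].
- have /andP[/dhomogP hp _] := hF p pF.
  rewrite (mpolyE p) big_seq; elim/big_ind: _ => [|a b ha hb|m mp].
  + by rewrite -mpolyC0; apply: gen_subalg_const.
  + exact: gen_subalg_add.
  + rewrite -mul_mpolyC; apply: gen_subalg_mul; first exact: gen_subalg_const.
    by apply: gen_subalg_mem; exists m => //; apply: hp.
- exact: gen_subalg_const.
- exact: gen_subalg_add.
- exact: gen_subalg_mul.
Qed.

End Subalgebras.

Section LinearSyzygies.
Variables (k : fieldType) (n q : nat).
Local Notation R := {mpoly k[n]}.

(* Note that 0 is homogeneous of every degree for the library. *)
Definition linear_syzygy (F : q.-tuple R) (l : 'cV[R]_q) : Prop :=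
  (forall i, l i 0 \is 1.-homog) /\ \sum_(i < q) l i 0 * tnth F i = 0.

(* The linear syzygy matrix is determined only up to the choice of a finite
   k-spanning family of its columns, hence a predicate on M. *)
Definition linear_syzygy_matrix (F : q.-tuple R) (c : nat)
    (M : 'M[R]_(q, c)) : Prop :=
  (forall j, linear_syzygy F (col j M)) /\
  (forall l, linear_syzygy F l ->
     exists a : 'cV[k]_c, l = \sum_(j < c) (a j 0)%:MP *: col j M).

Definition frac_rank (c : nat) (M : 'M[R]_(q, c)) : nat :=
  \rank (map_mx (@tofrac R) M).

End LinearSyzygies.

(* Main.v *)
(** Grade the polynomial ring by the degree in the Y-variables. Every form of
    [F] has Y-degree [d] or [0], so all monomials of elements of [k[F]] have
    Y-degree divisible by [d]; this excludes [z / y] (with [y] in [Y] and [z]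
    in [Z]) from the fraction field of [k[F]]. For a linear syzygy, the partial
    sum over [G] lives in Y-degree at least [d >= 2] and the partial sum over
    [H] in Y-degree at most [1], so both vanish: the syzygy matrix has two
    independent left kernel vectors and its rank is at most [q - 2]. *)
Require Import Defs.
From mathcomp Require Import all_boot all_order all_algebra.
From mathcomp Require Import mpoly.

Set Implicit Arguments.
Unset Strict Implicit.
Unset Printing Implicit Defensive.

Import GRing.Theory.

Local Open Scope ring_scope.

Section PartialDegree.
Variables (k : fieldType) (n : nat) (Y : {set 'I_n}).
Implicit Types (m : 'X_{1..n}) (p q : {mpoly k[n]}).

Definition pdeg m : nat := (\sum_(i in Y) m i)%N.

Lemma pdegD m1 m2 : pdeg (m1 + m2)%MM = (pdeg m1 + pdeg m2)%N.
Proof. by rewrite /pdeg -big_split; apply: eq_bigr => i _; rewrite mnmDE. Qed.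

Lemma pdeg0 : pdeg 0%MM = 0%N.
Proof. by rewrite /pdeg big1 // => i _; rewrite mnm0E. Qed.

Lemma pdegMn m j : pdeg (m *+ j)%MM = (pdeg m * j)%N.
Proof.
by rewrite /pdeg big_distrl; apply: eq_bigr => i _; rewrite mulmnE.
Qed.

Lemma pdeg1 i : pdeg U_(i)%MM = (i \in Y).
Proof.
rewrite /pdeg; have [iY|niY] := boolP (i \in Y).
  rewrite (bigD1 i) //= mnm1E eqxx big1 ?addn0 // => j /andP[_ nji].
  by rewrite mnm1E eq_sym (negbTE nji).
rewrite big1 // => j jY; rewrite mnm1E.
by have [eij|//] := eqVneq i j; rewrite eij jY in niY.
Qed.

Lemma leq_pdeg_mdeg m : (pdeg m <= mdeg m)%N.
Proof. by rewrite mdegE [leqRHS](bigID (mem Y)) /= leq_addr. Qed.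

Lemma pdeg_involves p m :
  involves_only Y p -> m \in msupp p -> pdeg m = mdeg m.
Proof.
move=> pY mp; rewrite mdegE [RHS](bigID (mem Y)) /= [X in (_ + X)%N]big1 ?addn0 //.
by move=> i niY; apply/eqP; apply: contraNT niY; apply: pY mp.
Qed.

Lemma pdeg_avoids (Z : {set 'I_n}) p m : [disjoint Y & Z] ->
  involves_only Z p -> m \in msupp p -> pdeg m = 0%N.
Proof.
move=> dYZ pZ mp; rewrite /pdeg big1 // => i iY; apply/eqP.
by apply: contraTT iY => mi; rewrite (disjointFl dYZ) // (pZ m).
Qed.

(** A monomial in the support would satisfy both [P] and its negation. Each half of the theorem
    equates two polynomials with incompatible Y-degrees and concludes here that both are zero. *)
Lemma eq_mpoly0_support (P : pred 'X_{1..n}) p :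
  all P (msupp p) -> all (predC P) (msupp p) -> p = 0.
Proof.
move=> /allP pP /allP pN; apply/eqP; rewrite -msupp_eq0.
case E: (msupp p) => [//|m s].
have mp : m \in msupp p by rewrite E mem_head.
by have := pN m mp; rewrite /= (pP m mp).
Qed.

Lemma all_msupp_sum (P : pred 'X_{1..n}) (I : finType) (Q : pred I)
    (f : I -> {mpoly k[n]}) :
  (forall i, Q i -> all P (msupp (f i))) -> all P (msupp (\sum_(i | Q i) f i)).
Proof.
move=> fP; elim/big_ind: _ => [|p q /allP hp /allP hq|//]; first by rewrite msupp0.
by apply/allP => m /msuppD_le; rewrite mem_cat => /orP[/hp|/hq].
Qed.

Lemma all_msuppM (P P1 P2 : pred 'X_{1..n}) p q :
  (forall m1 m2, P1 m1 -> P2 m2 -> P (m1 + m2)%MM) ->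
  all P1 (msupp p) -> all P2 (msupp q) -> all P (msupp (p * q)).
Proof.
move=> PP /allP hp /allP hq; apply/allP => m /msuppM_le /allpairsP[[m1 m2]].
by move=> [/= /hp h1 /hq h2 ->]; apply: PP.
Qed.

(** Multiples of [d] contain 0, the Y-degree of constants, and are closed under addition, so the
    property passes from generators to sums and products. *)
Lemma gen_subalg_pdeg_dvd (d : nat) (A : {mpoly k[n]} -> Prop) p :
  (forall f, A f -> all (fun m => d %| pdeg m)%N (msupp f)) ->
  gen_subalg A p -> all (fun m => d %| pdeg m)%N (msupp p).
Proof.
move=> hA; elim=> {p} [p /hA //|c|p q _ /allP hp _ /allP hq|p q _ hp _ hq].
- by rewrite msuppC; case: (c == 0); rewrite //= pdeg0 dvdn0.
- by apply/allP => m /msuppD_le; rewrite mem_cat => /orP[/hp|/hq].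
- by apply: all_msuppM hp hq => m1 m2 h1 h2; rewrite pdegD dvdn_add.
Qed.

(** If [Y] were empty, the leading monomial would have degree 0 instead of [d]. This supplies the
    variables [y] and [z] of the fraction used against birationality. *)
Lemma form_variable (d : nat) p : (0 < d)%N -> is_form d p ->
  involves_only Y p -> exists i, i \in Y.
Proof.
move=> d0 /andP[/dhomogP hp p0] pY; have mp := mlead_supp p0.
have [|[i iY]] := set_0Vmem Y; last by exists i.
have dE : mdeg (mlead p) = d := hp _ mp.
by move=> Y0; move: d0; rewrite -dE -(pdeg_involves pY mp) /pdeg Y0 big_set0.
Qed.

End PartialDegree.

Arguments all_msuppM {k n P} P1 P2 {p q}.

(** The restrictions of [f] to [P] and to its complement, extended by zero, are two left kernel
    vectors of [M]. They are nonzero with disjoint supports, hence independent. The additive form of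
    the bound avoids truncated subtraction. *)
Lemma rank_separated_left_kernel (K : fieldType) (q c : nat)
    (f : 'I_q -> K) (P : pred 'I_q) (M : 'M[K]_(q, c)) (i j : 'I_q) :
  P i -> f i != 0 -> ~~ P j -> f j != 0 ->
  (forall s, \sum_(r | P r) f r * M r s = 0) ->
  (forall s, \sum_(r | ~~ P r) f r * M r s = 0) ->
  (\rank M + 2 <= q)%N.
Proof.
move=> Pi fi Pj fj MP MN.
pose U : 'M[K]_(2, q) := \matrix_(b, r) (if P r == (b == 0) then f r else 0).
have UM : U *m M = 0.
  apply/matrixP=> b s; rewrite !mxE.
  under eq_bigr => r _ do rewrite mxE (fun_if (fun x => x * M r s)) mul0r.
  rewrite -big_mkcond; case: (b == 0).
    by rewrite -[RHS](MP s); apply: eq_bigl => r; rewrite eqb_id.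
  by rewrite -[RHS](MN s); apply: eq_bigl => r; rewrite eqbF_neg.
have I2 (b b' : 'I_2) : (b == 0) = (b' == 0) -> b = b'.
  by case: b b' => [[|[|//]] ?] [[|[|//]] ?] //= _; apply: val_inj.
have /eqP rkU : row_free U.
  apply: inj_row_free => v vU; apply/rowP=> b; rewrite mxE.
  (* In column [r] only row [b] of [U] is nonzero, so entry [r] of [v *m U] is [v 0 b * f r]. *)
  pose r := if b == 0 then i else j.
  have Pr : P r = (b == 0) by rewrite /r; case: (b == 0); rewrite // (negbTE Pj).
  have fr : f r != 0 by rewrite /r; case: (b == 0).
  have /rowP/(_ r) := vU; rewrite !mxE (bigD1 b) //= mxE Pr eqxx big1 => [|b' nb].
    by rewrite addr0 => /eqP; rewrite mulf_eq0 (negbTE fr) orbF => /eqP.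
  rewrite mxE Pr; case: eqP => [/I2 eb|_]; last by rewrite mulr0.
  by rewrite eb eqxx in nb.
by have := mulmx0_rank_max UM; rewrite rkU addnC.
Qed.

Theorem lemma4p1 (k : fieldType) (n q d : nat) (F : q.-tuple {mpoly k[n]})
    (Y Z : {set 'I_n}) (G H : seq {mpoly k[n]})
    (hd : (2 <= d)%N)
    (hFuniq : uniq F)
    (hFform : forall f, f \in F -> is_form d f)
    (hYZ : Y :|: Z = [set: 'I_n]) (hYZdisj : [disjoint Y & Z])
    (hFGH : forall f, (f \in F) = (f \in G) || (f \in H))
    (hG : forall g, g \in G -> involves_only Y g)
    (hH : forall h, h \in H -> involves_only Z h)
    (hG0 : G <> [::]) (hH0 : H <> [::]) :
  ~ birational (gen_subalg (fun f => f \in F)) (gen_subalg (@monomials k n d))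
  /\
  (forall (c : nat) (M : 'M[{mpoly k[n]}]_(q, c)),
     linear_syzygy_matrix F M -> frac_rank M <> q.-1).
Proof.
have [g gG] : exists g, g \in G.
  by case: G hG0 {hFGH hG} => // g G' _; exists g; rewrite mem_head.
have [h hinH] : exists h, h \in H.
  by case: H hH0 {hFGH hH} => // h H' _; exists h; rewrite mem_head.
have gF : g \in F by rewrite hFGH gG.
have hF : h \in F by rewrite hFGH hinH orbT.
have d0 : (0 < d)%N by apply: leq_trans hd.
have degG f m : f \in G -> m \in msupp f -> pdeg Y m = d.
  move=> fG mf; rewrite (pdeg_involves (hG f fG) mf).
  by have /andP[/dhomogP -> //] : is_form d f by rewrite hFform // hFGH fG.
have degH f m : f \in H -> m \in msupp f -> pdeg Y m = 0%N.
  by move=> fH; apply: pdeg_avoids hYZdisj (hH f fH).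
have F_neq0 f : f \in F -> f != 0 by move=> /hFform/andP[].
split.
  have [y yY] := form_variable d0 (hFform g gF) (hG g gG).
  have [z zZ] := form_variable d0 (hFform h hF) (hH h hinH).
  move=> bir.
  (* The fraction z / y, written as y^(d-1) z / y^d so that both terms are monomials of degree
     [d]. *)
  pose m1 : 'X_{1..n} := (U_(y) *+ d.-1 + U_(z))%MM.
  pose m2 : 'X_{1..n} := (U_(y) *+ d)%MM.
  have [_ /(_ _)[]] := bir (tofrac 'X_[k, m1] / tofrac 'X_[k, m2]).
    exists 'X_[k, m1], 'X_[k, m2]; split => //; last 1 first.
    - by rewrite -msupp_eq0 msuppX.
    - apply: gen_subalg_mem; exists m1 => //.
      by rewrite mdegD mdegMn !mdeg1 mul1n addn1 prednK.
    - by apply: gen_subalg_mem; exists m2; rewrite // mdegMn mdeg1 mul1n.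
  move=> a [b [ak bk b0]] /eqP.
  rewrite eqr_div ?tofrac_eq0 // -?msupp_eq0 ?msuppX //.
  rewrite -!tofracM tofrac_eq => /eqP ab.
  have degF f : f \in F -> all (fun m => d %| pdeg Y m)%N (msupp f).
    by rewrite hFGH => /orP[] fGH; apply/allP => m mf;
      rewrite ?(degG f m fGH mf) ?(degH f m fGH mf).
  have hda := gen_subalg_pdeg_dvd degF ak.
  have hdb := gen_subalg_pdeg_dvd degF bk.
  (* By [ab] this product equals [a * 'X_[k, m2]], whose Y-degrees are multiples of [d], whereas
     those of the product itself are congruent to d - 1 modulo [d]. *)
  have Xb0 : 'X_[k, m1] * b = 0.
    apply: (@eq_mpoly0_support _ _ (fun m => d %| pdeg Y m)%N).
      rewrite ab.
      apply: (all_msuppM _ (fun m => d %| pdeg Y m)%N _ hda).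
        by move=> u v hu hv; rewrite pdegD dvdn_add.
      by rewrite msuppX /= pdegMn dvdn_mull.
    apply: (all_msuppM (pred1 m1) _ _ _ hdb); last by rewrite msuppX /= eqxx.
    (* Here [d >= 2] enters: 0 < d - 1 < d, so [d] does not divide d - 1. *)
    move=> _ v /eqP -> hv /=; rewrite pdegD dvdn_addl // /m1 pdegD pdegMn !pdeg1.
    rewrite yY (disjointFl hYZdisj zZ) mul1n addn0 gtnNdvd ?prednK //.
    by rewrite -subn1 subn_gt0.
  by move/eqP: Xb0; rewrite mulf_eq0 (negbTE b0) -msupp_eq0 msuppX.
move=> c M [Msyz _] rkM.
pose P := [pred i : 'I_q | tnth F i \in G].
have NGH i : ~~ P i -> tnth F i \in H.
  by move=> /= nG; have := mem_tnth i F; rewrite hFGH (negbTE nG).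
have sums0 s : (\sum_(r | P r) tnth F r * M r s = 0) /\
               (\sum_(r | ~~ P r) tnth F r * M r s = 0).
  have [Mlin] := Msyz s.
  under eq_bigr => r _ do rewrite mxE mulrC.
  rewrite (bigID P) /= => sum0.
  have M1 r : all (fun m => pdeg Y m <= 1)%N (msupp (M r s)).
    apply/allP => m; have /dhomogP hM := Mlin r; rewrite mxE in hM.
    by move=> /hM /= <-; apply: leq_pdeg_mdeg.
  have SG0 : \sum_(r | P r) tnth F r * M r s = 0.
    apply: (@eq_mpoly0_support _ _ (fun m => 2 <= pdeg Y m)%N).
      apply: all_msupp_sum => r Pr.
      apply: (all_msuppM (fun m => pdeg Y m == d) _ _ _ (M1 r)).
        by move=> u v /eqP hu _; rewrite pdegD hu (leq_trans hd) ?leq_addr.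
      by apply/allP => m mf; rewrite (degG _ _ Pr mf).
    (* The syzygy relation turns the [G]-sum into minus the [H]-sum, whose Y-degrees come from the
       linear entries of [M] alone. *)
    move/eqP: sum0; rewrite addr_eq0 => /eqP ->.
    rewrite (perm_all _ (msuppN _)).
    apply: all_msupp_sum => r /NGH Hr.
    apply: (all_msuppM (fun m => pdeg Y m == 0%N) _ _ _ (M1 r)).
      by move=> u v /eqP hu hv; rewrite /= pdegD hu -leqNgt.
    by apply/allP => m mf; rewrite (degH _ _ Hr mf).
  by split=> //; move: sum0; rewrite SG0 add0r.
have [i Fi] := tnthP _ _ gF.
have [j Fj] := tnthP _ _ hF.
have Pi : P i by rewrite /= -Fi.
(* [G] and [H] cannot share a form: its leading monomial would have Y-degree both [d] and 0. *)
have Pj : ~~ P j.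
  rewrite /= -Fj; apply/negP => hinG.
  have mh := mlead_supp (F_neq0 h hF).
  by move: d0; rewrite -(degG _ _ hinG mh) (degH _ _ hinH mh).
have Ff0 r : tofrac (tnth F r) != 0 by rewrite tofrac_eq0 F_neq0 ?mem_tnth.
(* The rank is taken over the fraction field, so the two relations are carried there. *)
have frac0 (Q : pred 'I_q) s : \sum_(r | Q r) tnth F r * M r s = 0 ->
    \sum_(r | Q r) tofrac (tnth F r) * map_mx (@tofrac _) M r s = 0.
  move=> S0; rewrite -[RHS]tofrac0 -S0 raddf_sum /=.
  by apply: eq_bigr => r _; rewrite mxE rmorphM.
have := rank_separated_left_kernel Pi (Ff0 i) Pj (Ff0 j)
  (fun s => frac0 _ s (sums0 s).1) (fun s => frac0 _ s (sums0 s).2).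
move: rkM; rewrite /frac_rank => ->; rewrite addn2.
(* The case [q = 0], where [q.-1] is 0, is refuted separately, since the bound then reads 2 <= 0. *)
by case: (q) => // q'; rewrite ltnn.
Qed.
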